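(* Let $E$ be a uniformly smooth and uniformly convex real Banach space with dual space $E^{*}$ and normalized duality map $J$, and let $C$ be a nonempty closed and convex subset of $E$ such that $JC$ is closed and convex. Let $\{f_i\}_{i=1}^{\infty}$ be a countable family of bifunctions from $JC\times JC$ to $\mathbb{R}$, each satisfying conditions (A1)-(A4) listed in the context; let $\{A_j\}_{j=1}^{\infty}$ be a countable family of continuous monotone mappings from $C$ into $E^{*}$; and let $\{T_n\}_{n=1}^{\infty}$ be a countable family of generalized $J_{*}$-nonexpansive maps from $C$ into $E^{*}$. Let $\Gamma$ be a family of $J_{*}$-closed and generalized $J_{*}$-nonexpansive maps from $C$ into $E^{*}$ such that $$\bigcap_{n=1}^{\infty}F_J(T_n)=F_J(\Gamma)\neq\emptyset .$$ Assume that $\{T_n\}$ satisfies the NST-condition with $\Gamma$, and suppose that the common solution set $$B:=F_J(\Gamma)\cap\Big[\bigcap_{i=1}^{\infty}EP(f_i)\Big]\cap\Big[\bigcap_{j=1}^{\infty}VI(C,A_j)\Big]$$ is nonempty, closed and convex. Let $\mu,\nu:\mathbb{N}\to\mathbb{N}$ be maps such that $\{n:\mu(n)=i\}$ and $\{n:\nu(n)=j\}$ are infinite for all $i,j\in\mathbb{N}$. Let $h:C\to C$ be a contraction with coefficient $\rho\in(0,1)$ and let $\bar u\in C$. Let $\{\lambda_n\},\{\sigma_n\}\subset[0,1)$ satisfy $\lambda_n+\sigma_n<1$ for all $n$, $\lambda_n\to0$ and $\sigma_n\to 0$. Let $\alpha_1,\alpha_2,\alpha_3\in(0,1)$ with $\alpha_1+\alpha_2+\alpha_3=1$,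 and let $\{r_n\}\subset[a,\infty)$ for some $a>0$. Starting from $x_1\in C$ and $C_1=C$, define for all $n\ge1$ $$\begin{aligned} s_n&=J^{-1}\big(\lambda_nJh(x_n)+\sigma_nJ\bar u+(1-\lambda_n-\sigma_n)Jx_n\big),\\ z_n&=\Big\{z\in C: f_{\mu(n)}(Jz,Jy)+\tfrac1{r_n}\langle y-z,Jz-Js_n\rangle\ge0\ \ \forall y\in C\Big\},\\ u_n&=\Big\{z\in C:\langle y-z,A_{\nu(n)}z\rangle+\tfrac1{r_n}\langle y-z,Jz-Js_n\rangle\ge0\ \ \forall y\in C\Big\},\\ y_n&=J^{-1}\big(\alpha_1Js_n+\alpha_2Jz_n+\alpha_3T_nu_n\big),\\ C_{n+1}&=\{v\in C_n:\phi(v,y_n)\le\phi(v,s_n)\},\\ x_{n+1}&=\Pi_{C_{n+1}}x_1 . \end{aligned}$$ Set $q:=\Pi_Bx_1$. Then $q$ is the unique point in $B$ satisfying $$\langle p-q,Jx_1-Jq\rangle\le0\qquad\forall p\in B .$$ Equivalently, the strong limit of $\{x_n\}$ is characterized as the unique solution $q\in B$ of this variational inequality on $B$.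
   Context: Notation. $\langle x,x^{*}\rangle$ is the pairing of $x\in E$ with $x^{*}\in E^{*}$. The normalized duality map is $Jx=\{x^{*}\in E^{*}:\langle x,x^{*}\rangle=\|x\|\|x^{*}\|,\ \|x\|=\|x^{*}\|\}$; for $E$ uniformly smooth and uniformly convex it is a single-valued bijection $E\to E^{*}$, and $J_{*}=J^{-1}:E^{*}\to E$. Lyapunov functional: $\phi(x,y)=\|x\|^2-2\langle x,Jy\rangle+\|y\|^2$ for $x,y\in E$. For a nonempty closed convex $K\subset E$ and $x\in E$, the generalized projection $\Pi_Kx$ is the unique point of $K$ with $\phi(\Pi_Kx,x)=\inf_{y\in K}\phi(y,x)$. $J$-fixed points: for $T:C\to E^{*}$, $F_J(T)=\{p\in C:Tp=Jp\}$; for a family $\Gamma$ of such maps, $F_J(\Gamma)=\bigcap_{T\in\Gamma}F_J(T)$. $T:C\to E^{*}$ is generalized $J_{*}$-nonexpansive if $F_J(T)\ne\emptyset$ and $\phi(p,(J_{*}\circ T)x)\le\phi(p,x)$ for all $x\in C$, $p\in F_J(T)$. $T$ is $J_{*}$-closed if whenever $x_n\to x$ and $(J_{*}\circ T)x_n\to y$ (with $x_n\in C$), then $(J_{*}\circ T)x=y$. NST-condition: given families $\{T_n\}$ and $\Gamma$ of generalized $J_{*}$-nonexpansive maps from $C$ into $E^{*}$ with $\bigcap_nF_J(T_n)=F_J(\Gamma)\ne\emptyset$, $\{T_n\}$ satisfies the NST-condition with $\Gamma$ if for each bounded sequence $\{x_n\}\subset C$, $\|Jx_n-T_nx_n\|\to0$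 implies $\|Jx_n-Tx_n\|\to0$ for all $T\in\Gamma$. Conditions on a bifunction $f:JC\times JC\to\mathbb{R}$: (A1) $f(x^{*},x^{*})=0$ for all $x^{*}\in JC$; (A2) $f(x^{*},y^{*})+f(y^{*},x^{*})\le0$ for all $x^{*},y^{*}\in JC$; (A3) $\limsup_{t\downarrow0}f(tz^{*}+(1-t)x^{*},y^{*})\le f(x^{*},y^{*})$ for all $x^{*},y^{*},z^{*}\in JC$; (A4) for each $x^{*}\in JC$, $f(x^{*},\cdot)$ is convex and lower semicontinuous. Solution sets: $EP(f)=\{x\in C:f(Jx,Jy)\ge0\ \forall y\in C\}$; for $A:C\to E^{*}$, $VI(C,A)=\{x\in C:\langle y-x,Ax\rangle\ge0\ \forall y\in C\}$. $A$ is monotone if $\langle x-y,Ax-Ay\rangle\ge0$ for all $x,y\in C$. Convention: ''$z_n=\{z\in C:\dots\}$'' and ''$u_n=\{z\in C:\dots\}$'' mean that the set on the right is a singleton whose unique element is $z_n$, respectively $u_n$. *)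

(* Defs.v *)
From HB Require Import structures.
From mathcomp Require Import all_boot all_order all_algebra.
From mathcomp Require Import all_classical all_reals all_analysis.

Set Implicit Arguments.
Unset Strict Implicit.
Unset Printing Implicit Defensive.

Import Order.TTheory GRing.Theory Num.Theory.
Import numFieldNormedType.Exports.

Local Open Scope classical_set_scope.
Local Open Scope ring_scope.

Section Dual.
Variables (R : realType) (E : normedModType R).

Definition continuous_functional : {pred E -> R^o} :=
  fun f => `[< linear f /\ continuous f >].

Lemma continuous_functional_submod_closed : submod_closed continuous_functional.
Proof.
split=> [|a f g /asboolP[lf cf] /asboolP[lg cg]]; apply/asboolP.
  split; last by move=> x; apply: cst_continuous.
  by move=> a u v /=; rewrite /GRing.zero /= scaler0 addr0.
split.
  move=> b u v; rewrite !fctE lf lg; rewrite !scalerDr !scalerA mulrC.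
  by rewrite -!addrA; congr (_ + _); rewrite addrCA.
by move=> x; apply: continuousD; [apply: continuousZl_tmp; exact: cf|exact: cg].
Qed.

HB.instance Definition _ := GRing.isSubmodClosed.Build R (E -> R^o)
  continuous_functional continuous_functional_submod_closed.

Record dualSpace := DualSpace {
  dual_fun :> E -> R^o ;
  dual_funP : dual_fun \in continuous_functional }.

HB.instance Definition _ := [isSub for dual_fun].
HB.instance Definition _ := [Choice of dualSpace by <:].
HB.instance Definition _ := [SubChoice_isSubLmodule of dualSpace by <:].

Definition pairing (x : E) (f : dualSpace) : R := f x.

Implicit Types (f g : dualSpace) (x y : E) (a : R).

Lemma pairingDr x f g : pairing x (f + g) = pairing x f + pairing x g.
Proof. by []. Qed.

Lemma pairingNr x f : pairing x (- f) = - pairing x f.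
Proof. by []. Qed.

Lemma pairingBr x f g : pairing x (f - g) = pairing x f - pairing x g.
Proof. by []. Qed.

Lemma pairingZr x a f : pairing x (a *: f) = a * pairing x f.
Proof. by []. Qed.

Lemma dualSpace_linear f : linear f.
Proof. by case: f => f /= /asboolP[]. Qed.

Lemma dualSpace_continuous f : continuous f.
Proof. by case: f => f /= /asboolP[]. Qed.

HB.instance Definition _ f :=
  GRing.isLinear.Build R E R^o *:%R f (dualSpace_linear f).

Lemma pairingDl x y f : pairing (x + y) f = pairing x f + pairing y f.
Proof. exact: linearD. Qed.

Lemma pairingNl x f : pairing (- x) f = - pairing x f.
Proof. exact: linearN. Qed.

Lemma pairingBl x y f : pairing (x - y) f = pairing x f - pairing y f.
Proof. exact: linearB. Qed.

Lemma pairingZl a x f : pairing (a *: x) f = a * pairing x f.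
Proof. exact: linearZ. Qed.

Lemma pairing0l f : pairing 0 f = 0.
Proof. exact: linear0. Qed.

Definition dual_norm f : R :=
  sup [set `|pairing x f| | x in [set x : E | `|x| <= 1]].

Lemma dual_norm_has_sup f :
  has_sup [set `|pairing x f| | x in [set x : E | `|x| <= 1]].
Proof.
split; first by exists `|pairing 0 f|, 0 => //=; rewrite normr0.
have /linear_bounded_continuous/linear_boundedP/pinfty_ex_gt0[M M0 fM] :=
  @dualSpace_continuous f.
exists M => _ [x /= x1 <-]; apply: le_trans (fM x) _.
by rewrite ler_piMr// ltW.
Qed.

Lemma dual_norm_ub f x : `|x| <= 1 -> `|pairing x f| <= dual_norm f.
Proof.
by move=> x1; apply: ub_le_sup; [exact: (dual_norm_has_sup f).2|exists x].
Qed.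

Lemma dual_norm_le f a :
  (forall x, `|x| <= 1 -> `|pairing x f| <= a) -> dual_norm f <= a.
Proof.
move=> fa; apply: ge_sup; first exact: (dual_norm_has_sup f).1.
by move=> _ [x /= x1 <-]; exact: fa.
Qed.

Lemma ler_dual_normD f g : dual_norm (f + g) <= dual_norm f + dual_norm g.
Proof.
apply: dual_norm_le => x x1; rewrite pairingDr (le_trans (ler_normD _ _))//.
by rewrite lerD// dual_norm_ub.
Qed.

Lemma dual_normZ a f : dual_norm (a *: f) = `|a| * dual_norm f.
Proof.
have le_scale (b : R) g : dual_norm (b *: g) <= `|b| * dual_norm g.
  by apply: dual_norm_le => x x1; rewrite pairingZr normrM ler_wpM2l// dual_norm_ub.
apply/eqP; rewrite eq_le le_scale/=.
have [->|a0] := eqVneq a 0.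
  rewrite normr0 mul0r (le_trans (normr_ge0 (pairing 0 (0 *: f))))//.
  by rewrite dual_norm_ub// normr0.
rewrite -ler_pdivlMl ?normr_gt0// -normfV.
by rewrite -[in leLHS](scale1r f) -(mulVf a0) -scalerA le_scale.
Qed.

Lemma dual_norm_eq0 f : dual_norm f = 0 -> f = 0.
Proof.
move=> f0; apply/val_inj/funext => x /=.
have [->|x0] := eqVneq x 0; first by rewrite linear0.
have nx0 : `|x| != 0 by rewrite normr_eq0.
have : `| `|x|^-1 *: x| <= 1 by rewrite normrZ normfV normr_id mulVf.
move=> /(dual_norm_ub f); rewrite f0 normr_le0 pairingZl mulf_eq0 invr_eq0.
by rewrite (negbTE nx0) => /eqP.
Qed.

HB.instance Definition _ := Lmodule_isNormed.Build R dualSpace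
  ler_dual_normD dual_normZ dual_norm_eq0.

End Dual.

Section UniformGeometry.
Variables (R : realType) (E : normedModType R).

Definition uniformly_convex := forall e : R, 0 < e -> e <= 2 ->
  exists2 d : R, 0 < d & forall x y : E,
    `|x| = 1 -> `|y| = 1 -> e <= `|x - y| -> `|2^-1 *: (x + y)| <= 1 - d.

Definition smoothness_modulus (t : R) : R :=
  sup [set (`|xy.1 + t *: xy.2| + `|xy.1 - t *: xy.2|) / 2 - 1 |
    xy in [set xy : E * E | `|xy.1| = 1 /\ `|xy.2| = 1]].

Definition uniformly_smooth := smoothness_modulus t / t @[t --> 0^'+] --> (0 : R).

End UniformGeometry.
Arguments uniformly_convex {R} E.
Arguments smoothness_modulus {R} E t.
Arguments uniformly_smooth {R} E.

Section Duality.
Variables (R : realType) (E : normedModType R).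
Implicit Types (C K : set E) (T : E -> dualSpace E).

Definition duality_set (x : E) : set (dualSpace E) :=
  [set f | pairing x f = `|x| * `|f| /\ `|x| = `|f|].

(* [J] and [Jinv] are the maps of the text only when the sets below are
   singletons, which is the case in uniformly convex and uniformly smooth
   Banach spaces; the same holds for [gproj] when [K] is moreover nonempty,
   closed and convex. *)
Definition J (x : E) : dualSpace E := get (duality_set x).

Definition Jinv (f : dualSpace E) : E := get [set x | J x = f].

Definition phi (x y : E) : R := `|x| ^+ 2 - 2 * pairing x (J y) + `|y| ^+ 2.

Definition gproj K (x : E) : E :=
  get [set p | K p /\ phi p x = inf [set phi y x | y in K]].

(* A mapping defined on [C] is represented by a total function, of which only
   the values on [C] are used. *)
Definition FJ C T : set E := [set p | C p /\ T p = J p].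

Definition FJ_family C (Gamma : set (E -> dualSpace E)) : set E :=
  [set p | C p /\ forall T, Gamma T -> FJ C T p].

Definition generalized_Jstar_nonexpansive C T :=
  FJ C T !=set0 /\
  forall x p, C x -> FJ C T p -> phi p (Jinv (T x)) <= phi p x.

Definition Jstar_closed C T := forall (x_ : nat -> E) (x y : E),
  (forall n, C (x_ n)) -> x_ @ \oo --> x ->
  (fun n => Jinv (T (x_ n))) @ \oo --> y -> Jinv (T x) = y.

Definition NST_condition C (T_ : nat -> E -> dualSpace E)
    (Gamma : set (E -> dualSpace E)) :=
  forall x_ : nat -> E, (forall n, C (x_ n)) -> bounded_set (range x_) ->
    (fun n => `|J (x_ n) - T_ n (x_ n)|) @ \oo --> (0 : R) ->
  forall T, Gamma T -> (fun n => `|J (x_ n) - T (x_ n)|) @ \oo --> (0 : R).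

Definition monotone_on C (A : E -> dualSpace E) :=
  forall x y, C x -> C y -> 0 <= pairing (x - y) (A x - A y).

Definition EP C (f : dualSpace E -> dualSpace E -> R) : set E :=
  [set x | C x /\ forall y, C y -> 0 <= f (J x) (J y)].

Definition VI C (A : E -> dualSpace E) : set E :=
  [set x | C x /\ forall y, C y -> 0 <= pairing (y - x) (A x)].

End Duality.

Section Bifunctions.
Variables (R : realType) (F : normedModType R) (D : set F) (f : F -> F -> R).

Definition bifun_A1 := forall x, D x -> f x x = 0.

Definition bifun_A2 := forall x y, D x -> D y -> f x y + f y x <= 0.

Definition bifun_A3 := forall x y z, D x -> D y -> D z ->
  (limf_esup (fun t : R => (f (t *: z + (1 - t) *: x) y)%:E) 0^'+
     <= (f x y)%:E)%E.

(* [subspace D] gives lower semicontinuity relative to [D]: its points outside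
   [D] are isolated. *)
Definition bifun_A4 := forall x, D x ->
  convex_function (D : set (convex_lmodType F)) (f x) /\
  lower_semicontinuous (fun y : subspace D => (f x y)%:E).

Definition bifun_conditions := [/\ bifun_A1, bifun_A2, bifun_A3 & bifun_A4].

End Bifunctions.

(* Main.v *)
Require Import Defs.
From HB Require Import structures.
From mathcomp Require Import all_boot all_order all_algebra.
From mathcomp Require Import all_classical all_reals all_analysis.
From mathcomp Require Import ring lra.
Import Order.TTheory GRing.Theory Num.Theory.
Import numFieldNormedType.Exports.
Local Open Scope classical_set_scope.
Local Open Scope ring_scope.

Set Implicit Arguments.
Unset Strict Implicit.
Unset Printing Implicit Defensive.

(* Uniform convexity, in the form of a modulus for the midpoint convexity of the
   squared norm on balls, makes minimizing sequences of [|y|^2 - 2 f(y)] on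
   closed convex sets Cauchy.  This gives at once the generalized projections,
   the surjectivity of [J], and the fact that [phi x y] small forces [x] and [y]
   to be close, hence the continuity of [J^-1]; uniform smoothness gives the
   single-valuedness and the continuity of [J].

   Every [K n] is closed, convex and contains [B]: for [b] in [B] the resolvent
   inequalities and the convexity of [phi b o J^-1] give
     phi b (y n) + alpha2 phi (z n) (s n) + alpha3 phi (u n) (s n) <= phi b (s n).
   The identity [phi v (x n) + phi (x n) (x 0) <= phi v (x 0)] on [K n] makes [x]
   Cauchy; let [p] be its limit.  Then [s n], and by the definition of [K n.+1]
   also [y n], tend to [p], so the displayed inequality forces [z n] and [u n] to
   tend to [p].  Since [alpha3 > 0], the definition of [y n] now yields
   [T n (u n) --> J p], and the NST-condition applies.  Thus [p] is in [B]; as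
   [x n] minimizes [phi (.) (x 0)] on a set containing [B], so does [p], and
   minimizers of [phi (.) (x 0)] on [B] are characterized by the variational
   inequality. *)

(** * Uniform convexity *)

(** If [a - b > c + 1] with [c >= 0], then [(a - b)^2 > c]. This turns bounds on [phi] into norm
    bounds without square roots. *)
Lemma ler_sqr_dist (R : realFieldType) (a b c : R) :
  (a - b) ^+ 2 <= c -> a <= b + c + 1.
Proof.
move=> abc; have c0 := le_trans (sqr_ge0 _) abc.
rewrite leNgt; apply/negP => lt_a; move: abc; apply/negP; rewrite -ltNge.
have : 0 <= (a - b - c - 1) * (a - b + c + 1) by rewrite mulr_ge0; lra.
have := sqr_ge0 c; nra.
Qed.

Lemma sqr_convex3 (R : realDomainType) (a1 a2 a3 x y z : R) :
  0 <= a1 -> 0 <= a2 -> 0 <= a3 -> a1 + a2 + a3 = 1 ->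
  (a1 * x + a2 * y + a3 * z) ^+ 2 <= a1 * x ^+ 2 + a2 * y ^+ 2 + a3 * z ^+ 2.
Proof.
move=> a10 a20 a30 a1E; rewrite -subr_ge0.
have -> : a1 * x ^+ 2 + a2 * y ^+ 2 + a3 * z ^+ 2 -
    (a1 * x + a2 * y + a3 * z) ^+ 2 =
    a1 * a2 * (x - y) ^+ 2 + a1 * a3 * (x - z) ^+ 2 + a2 * a3 * (y - z) ^+ 2.
  have -> : a3 = 1 - a1 - a2 by rewrite -a1E; ring.
  by ring.
by rewrite !addr_ge0// mulr_ge0 ?sqr_ge0// mulr_ge0.
Qed.

Section UniformConvexity.
Context {R : realType} {E : normedModType R}.
Implicit Types (x y : E) (M e : R).

(** If the norms differ by at least [e / 4], the convexity of the real square suffices. Otherwise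
    the normalized vectors stay separated and uniform convexity applies on the sphere. *)
Lemma uniformly_convex_sqr : uniformly_convex E -> forall M e, 0 < e ->
  exists2 d : R, 0 < d & forall x y, `|x| <= M -> `|y| <= M -> e <= `|x - y| ->
    `|2^-1 *: (x + y)| ^+ 2 <= (`|x| ^+ 2 + `|y| ^+ 2) / 2 - d.
Proof.
(* The maximum keeps [N] positive whatever [M] is and makes [e / (2 * N)] an admissible
   separation. *)
move=> uc M e e0; pose N := Num.max M e.
have N0 : 0 < N by rewrite lt_max e0 orbT.
have c0 : 0 < e / (2 * N) by rewrite divr_gt0// mulr_gt0.
have c2 : e / (2 * N) <= 2.
  rewrite ler_pdivrMr ?mulr_gt0//.
  have : e <= N by rewrite le_max lexx orbT.
  lra.
have [d d0 dP] := uc _ c0 c2.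
exists (Num.min (e ^+ 2 / 64) ((e * d / 4) ^+ 2)).
  by rewrite lt_min divr_gt0 ?exprn_gt0 ?divr_gt0 ?mulr_gt0.
suff H x y : `|y| <= `|x| -> `|x| <= M -> e <= `|x - y| ->
    `|2^-1 *: (x + y)| ^+ 2 <= (`|x| ^+ 2 + `|y| ^+ 2) / 2 -
      Num.min (e ^+ 2 / 64) ((e * d / 4) ^+ 2).
  move=> x y xM yM exy; have [yx|/ltW xy] := leP `|y| `|x|; first exact: H.
  by rewrite addrC [X in X / 2]addrC H// distrC.
move=> yx xM exy.
have S0 : `|2^-1 *: (x + y)| <= (`|x| + `|y|) / 2.
  by rewrite normrZ ger0_norm ?invr_ge0// mulrC ler_pM2r ?ler_normD.
have [far|near] := leP (e / 4) (`|x| - `|y|).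
  apply: (@le_trans _ _ ((`|x| ^+ 2 + `|y| ^+ 2) / 2 - e ^+ 2 / 64)); last first.
    by rewrite lerD2l lerN2 ge_min lexx.
  apply: (@le_trans _ _ (((`|x| + `|y|) / 2) ^+ 2)).
    by rewrite ler_sqr// nnegrE// divr_ge0// addr_ge0.
  have : (e / 4) ^+ 2 <= (`|x| - `|y|) ^+ 2 by rewrite ler_sqr// nnegrE; lra.
  by nra.
have xye : e <= `|x| + `|y| := le_trans exy (ler_normB _ _).
have y0 : 0 < `|y| by lra.
have x0 : 0 < `|x| by lra.
have x'1 : `| `|x|^-1 *: x| = 1.
  by rewrite normrZ normfV normr_id mulVf ?gt_eqF.
have y'1 : `| `|y|^-1 *: y| = 1.
  by rewrite normrZ normfV normr_id mulVf ?gt_eqF.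
(* After scaling by the norm of [x], the difference of the unit vectors is [x - y] up to an error of
   norm below [e / 4]. *)
have sep : e / (2 * N) <= `| `|x|^-1 *: x - `|y|^-1 *: y|.
  rewrite ler_pdivrMr ?mulr_gt0//.
  have xN : `|x| <= N by rewrite le_max xM.
  apply: (@le_trans _ _ (`| `|x|^-1 *: x - `|y|^-1 *: y| * (2 * `|x|))); last first.
    by rewrite ler_wpM2l// ler_pM2l.
  have -> : `| `|x|^-1 *: x - `|y|^-1 *: y| * (2 * `|x|) =
      2 * `|(x - y) - ((`|x| - `|y|) * `|y|^-1) *: y|.
    rewrite mulrCA; congr (_ * _); rewrite mulrC -{1}(normr_id x) -normrZ.
    rewrite scalerBr !scalerA divff ?gt_eqF// scale1r mulrBl divff ?gt_eqF//.
    by rewrite scalerBl scale1r opprB [in RHS]addrA subrK.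
  have := lerB_dist (x - y) (((`|x| - `|y|) * `|y|^-1) *: y).
  rewrite normrZ normrM normfV normr_id mulfVK ?gt_eqF// ger0_norm ?subr_ge0//.
  by lra.
have {}dP := dP _ _ x'1 y'1 sep.
have d1 : d <= 1 by have := le_trans (normr_ge0 _) dP; lra.
have {dP} mid : `|2^-1 *: (x + y)| <= (`|x| + `|y|) / 2 - `|y| * d.
  have -> : 2^-1 *: (x + y) = `|y| *: (2^-1 *: (`|x|^-1 *: x + `|y|^-1 *: y)) +
      ((`|x| - `|y|) / 2) *: (`|x|^-1 *: x).
    rewrite !scalerDr !scalerA addrAC -scalerDl; congr (_ *: _ + _ *: _).
      by field; rewrite gt_eqF.
    by field; rewrite gt_eqF.
  apply: le_trans (ler_normD _ _) _; rewrite [X in X + _]normrZ [X in _ + X]normrZ.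
  rewrite x'1 normr_id mulr1 ger0_norm; last by rewrite divr_ge0// subr_ge0.
  have := ler_wpM2l (ltW y0) dP; lra.
apply: (@le_trans _ _ ((`|x| ^+ 2 + `|y| ^+ 2) / 2 - (e * d / 4) ^+ 2)); last first.
  by rewrite lerD2l lerN2 ge_min lexx orbT.
have yd : `|y| * d <= `|y| by rewrite ler_piMr.
have yd0 : 0 < `|y| * d by rewrite mulr_gt0.
apply: (@le_trans _ _ (((`|x| + `|y|) / 2 - `|y| * d) ^+ 2)).
  by rewrite ler_sqr ?nnegrE// (le_trans _ mid).
have : (e * d / 4) ^+ 2 <= (`|y| * d) ^+ 2.
  rewrite ler_sqr ?nnegrE//; [|by rewrite divr_ge0// mulr_ge0// ltW|exact: ltW].
  by rewrite mulrAC ler_pM2r//; lra.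
(* With [m] the mean of the norms and [k] the gain, [k (m - k) >= 0] gives
   [(m - k)^2 <= m^2 - k^2]. *)
have : 0 <= (`|y| * d) * ((`|x| + `|y|) / 2 - `|y| * d).
  by rewrite mulr_ge0 ?(ltW yd0)//; lra.
have : 0 <= (`|x| - `|y|) ^+ 2 by exact: sqr_ge0.
move: (`|y| * d) (`|x|) (`|y|) => k a b.
set p := (e * d / 4) ^+ 2.
by lra.
Qed.

End UniformConvexity.

(** * Uniform smoothness and the norming functionals *)

Lemma ler_eq (R : numDomainType) (x y : R) : x = y -> x <= y.
Proof. by move=> ->. Qed.

Section Pairing.
Context {R : realType} {E : normedModType R}.
Implicit Types (x y : E) (f : dualSpace E).

Lemma pairing_norm_le x f : `|pairing x f| <= `|x| * `|f|.
Proof.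
have [->|x0] := eqVneq x 0; first by rewrite pairing0l !normr0 mul0r.
have nx0 : 0 < `|x| by rewrite normr_gt0.
have : `| `|x|^-1 *: x| <= 1 by rewrite normrZ normfV normr_id mulVf ?gt_eqF.
move=> /(dual_norm_ub f); rewrite pairingZl normrM normfV normr_id.
by rewrite ler_pdivrMl.
Qed.

Lemma pairing_le x f : pairing x f <= `|x| * `|f|.
Proof. exact: le_trans (ler_norm _) (pairing_norm_le _ _). Qed.

Lemma ler_dual_norm f (M : R) :
  (forall x, `|x| <= 1 -> pairing x f <= M) -> `|f| <= M.
Proof.
move=> fM; apply: dual_norm_le => x x1; rewrite ler_norml fM// andbT.
by rewrite lerNl -pairingNl fM// normrN.
Qed.

Lemma duality_setP x f :
  duality_set x f <-> pairing x f = `|x| ^+ 2 /\ `|f| = `|x|.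
Proof.
by rewrite /duality_set/=; split=> [[-> <-]|[-> ->]]; rewrite expr2.
Qed.

End Pairing.

Section Smoothness.
Context {R : realType} {E : normedModType R}.
Hypothesis smooth : uniformly_smooth E.
Implicit Types (x y v w : E) (f g : dualSpace E).

(** This is the modulus evaluated on the unit vectors along [x] and [w], rescaled by the norm of
    [x]; [e / 2] in the proof offsets the halving in the modulus. *)
Lemma uniformly_smooth_norm x (e : R) : x != 0 -> 0 < e ->
  exists2 d : R, 0 < d &
    forall w, `|w| <= d -> `|x + w| + `|x - w| <= 2 * `|x| + e * `|w|.
Proof.
move=> x0 e0; have nx0 : 0 < `|x| by rewrite normr_gt0.
have e20 : 0 < e / 2 by rewrite divr_gt0.
have /cvgrPdist_lt/(_ _ e20)[/= d d0 dP] := smooth.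
exists (d * `|x| / 2); first by rewrite !mulr_gt0 ?invr_gt0.
move=> w wd; have [->|w0] := eqVneq w 0.
  by rewrite addr0 subr0 normr0 mulr0 addr0 mulr_natl mulr2n.
have nw0 : 0 < `|w| by rewrite normr_gt0.
have t0 : 0 < `|w| / `|x| by rewrite divr_gt0.
set t := `|w| / `|x| in t0.
have td : t < d by rewrite /t ltr_pdivrMr//; nra.
have := dP t; rewrite /ball_/= !sub0r !normrN gtr0_norm// => /(_ td t0).
move=> /(le_lt_trans (ler_norm _)); rewrite ltr_pdivrMr// => rho.
have unit (z : E) : z != 0 -> `| `|z|^-1 *: z| = 1.
  by move=> z0; rewrite normrZ normfV normr_id mulVf// normr_eq0.
have : (`| `|x|^-1 *: x + t *: (`|w|^-1 *: w)| +
        `| `|x|^-1 *: x - t *: (`|w|^-1 *: w)|) / 2 - 1 <= @smoothness_modulus R E t.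
  apply: ub_le_sup; last first.
    by exists (`|x|^-1 *: x, `|w|^-1 *: w) => //=; rewrite !unit.
  (* By the triangle inequality, [t] bounds the set whose supremum is the modulus. *)
  exists t => _ [[a b] /= [a1 b1] <-].
  have := ler_normD a (t *: b); have := ler_normB a (t *: b).
  rewrite normrZ a1 b1 gtr0_norm// mulr1; lra.
rewrite scalerA /t mulrAC divff ?gt_eqF// mul1r -scalerDr -scalerBr !normrZ.
rewrite normfV normr_id -mulrDr => h.
have {h} h : `|x|^-1 * (`|x + w| + `|x - w|) <= 2 + e * t by lra.
have := ler_wpM2l (ltW nx0) h.
rewrite mulVKf ?gt_eqF// => /le_trans; apply; apply: ler_eq; rewrite /t; field.
by rewrite gt_eqF.
Qed.

(* A norming functional at [x] is obtained without the Hahn-Banach theorem, as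
   the one-sided directional derivative of the norm at [x]: it is sublinear in
   general, and smoothness makes it odd, hence linear. *)
Let quotient x v (t : R) : R := (`|x + t *: v| - `|x|) / t.
Let slope x v : R := inf [set quotient x v t | t in [set t | 0 < t]].

Let quotient_mono x v (s t : R) : 0 < s -> s <= t ->
  quotient x v s <= quotient x v t.
Proof.
move=> s0 st; have t0 : 0 < t := lt_le_trans s0 st.
rewrite /quotient ler_pdivrMr//.
have -> : x + s *: v = (s / t) *: (x + t *: v) + (1 - s / t) *: x.
  rewrite scalerDr scalerA divfK ?gt_eqF// scalerBl scale1r.
  by rewrite addrAC addrCA subrr addr0.
apply: (@le_trans _ _ (s / t * `|x + t *: v| + (1 - s / t) * `|x| - `|x|)).
  rewrite lerD2r (le_trans (ler_normD _ _))// [X in X + _]normrZ [X in _ + X]normrZ.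
  rewrite (gtr0_norm (x := s / t)) ?divr_gt0//.
  by rewrite ger0_norm// subr_ge0 ler_pdivrMr// mul1r.
by apply: ler_eq; field; rewrite gt_eqF.
Qed.

Let quotient_ge x v (t : R) : 0 < t -> - `|v| <= quotient x v t.
Proof.
move=> t0; rewrite ler_pdivlMr//.
have := lerB_dist x (x + t *: v); rewrite opprD addNKr normrN normrZ gtr0_norm//.
lra.
Qed.

Let slope_le x v (t : R) : 0 < t -> slope x v <= quotient x v t.
Proof.
move=> t0; apply: ge_inf; last by exists t.
by exists (- `|v|) => _ [s s0 <-]; exact: quotient_ge.
Qed.

Let slope_ge x v (M : R) : (forall t, 0 < t -> M <= quotient x v t) ->
  M <= slope x v.
Proof.
move=> MP; apply: lb_le_inf; first by exists (quotient x v 1), 1 => //=.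
by move=> _ [t t0 <-]; exact: MP.
Qed.

(** Quotients decrease with the step, so both can be compared at the common step [m]; the point
    reached by [v + w] at step [m / 2] is the midpoint of those reached by [v] and [w] at step
    [m]. *)
Let slopeD x v w : slope x (v + w) <= slope x v + slope x w.
Proof.
rewrite -lerBlDr; apply: slope_ge => t t0.
rewrite lerBlDr -lerBlDl; apply: slope_ge => s s0; rewrite lerBlDl.
pose m := Num.min t s; have m0 : 0 < m by rewrite lt_min t0.
apply: le_trans (@slope_le x (v + w) (m / 2) _) _; first by rewrite divr_gt0.
have mt : quotient x v m <= quotient x v t.
  by apply: quotient_mono => //; rewrite ge_min lexx.
have ms : quotient x w m <= quotient x w s.
  by apply: quotient_mono => //; rewrite ge_min lexx orbT.
apply: le_trans (lerD mt ms).
rewrite /quotient -mulrDl.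
rewrite ler_pdivrMr ?divr_gt0// mulrA [X in _ <= X / 2]divfK ?gt_eqF//.
have : `|x + (m / 2) *: (v + w)| <= (`|x + m *: v| + `|x + m *: w|) / 2.
  have -> : x + (m / 2) *: (v + w) = 2^-1 *: ((x + m *: v) + (x + m *: w)).
    have half (z : E) : z = 2^-1 *: (z + z).
      by rewrite -mulr2n -[z *+ 2]scaler_nat scalerA mulVf ?scale1r// pnatr_eq0.
    rewrite [LHS]half; congr (_ *: _).
    by rewrite addrACA -scalerDl -splitr scalerDr addrACA.
  by rewrite normrZ ger0_norm ?invr_ge0// mulrC ler_pM2r ?invr_gt0// ler_normD.
lra.
Qed.

Let slope_pZ x v (a : R) : 0 < a -> slope x (a *: v) = a * slope x v.
Proof.
have le b z : 0 < b -> slope x (b *: z) <= b * slope x z.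
  move=> b0; rewrite -ler_pdivrMl//; apply: slope_ge => t t0.
  rewrite ler_pdivrMl//.
  apply: le_trans (@slope_le x (b *: z) (t / b) _) _; first by rewrite divr_gt0.
  rewrite /quotient scalerA divfK ?gt_eqF//; apply: ler_eq; field.
  by rewrite !gt_eqF.
move=> a0; apply/eqP; rewrite eq_le le//= -ler_pdivlMl//.
rewrite -{1}[v](scale1r v) -(mulVf (lt0r_neq0 a0)) -scalerA.
by rewrite le// invr_gt0.
Qed.

(** Subadditivity gives one inequality. For the other, the quotients at [v] and [- v] add up to a
    symmetric second difference of the norm, which smoothness makes arbitrarily small. *)
Let slopeN x v : x != 0 -> slope x (- v) = - slope x v.
Proof.
move=> x0; apply/eqP; rewrite eq_le; apply/andP; split; last first.
  rewrite lerNl -subr_ge0 opprK.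
  apply: le_trans (slopeD x v (- v)).
  rewrite subrr; apply: slope_ge => t t0.
  by rewrite /quotient scaler0 addr0 subrr mul0r.
rewrite -subr_le0 opprK; apply/ler_addgt0Pr => e e0; rewrite add0r.
(* The added 1 covers the case [v = 0]. *)
have k0 : 0 < e / (`|v| + 1) by rewrite divr_gt0// ltr_wpDl.
have [d d0 dP] := uniformly_smooth_norm x0 k0.
have t0 : 0 < d / (`|v| + 1) by rewrite divr_gt0// ltr_wpDl.
set t := d / _ in t0.
apply: le_trans (lerD (slope_le _ (- v) t0) (slope_le _ v t0)) _.
rewrite /quotient -mulrDl ler_pdivrMr//.
have vv : `|v| / (`|v| + 1) <= 1.
  by rewrite ler_pdivrMr ?ltr_wpDl// mul1r lerDl.
have td : `|t *: v| <= d.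
  by rewrite normrZ gtr0_norm// /t mulrAC -mulrA ler_piMr// ltW.
have := dP _ td; rewrite normrZ gtr0_norm// scalerN.
have -> : e / (`|v| + 1) * (t * `|v|) = e * t * (`|v| / (`|v| + 1)).
  by field; rewrite gt_eqF// ltr_wpDl.
have := ler_wpM2l (ltW (mulr_gt0 e0 t0)) vv.
lra.
Qed.

Lemma norming_functional x : x != 0 ->
  exists2 f : dualSpace E, pairing x f = `|x| & `|f| = 1.
Proof.
move=> x0; have nx0 : 0 < `|x| by rewrite normr_gt0.
have slopeZ a v : slope x (a *: v) = a * slope x v.
  have [a0|a0|<-] := ltgtP 0 a; first exact: slope_pZ.
    rewrite -{1}[a]opprK scaleNr slopeN// slope_pZ ?oppr_gt0//.
    by rewrite mulNr opprK.
  rewrite mul0r scale0r; have := slopeN 0 x0; rewrite oppr0; lra.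
have lin : linear (slope x : E -> R^o).
  move=> a v w; rewrite -[RHS]/(a * slope x v + slope x w) -slopeZ.
  apply/eqP; rewrite eq_le slopeD/=.
  (* Subadditivity at the opposite vectors is the reverse inequality, by oddness. *)
  rewrite -lerN2 opprD -!slopeN// opprD; exact: slopeD.
have slope_norm v : slope x v <= `|v|.
  apply: le_trans (slope_le x v ltr01) _.
  by rewrite /quotient divr1 scale1r lerBlDl ler_normD.
have slope_abs v : `|slope x v| <= `|v|.
  by rewrite ler_norml slope_norm andbT lerNl -slopeN// -[`|v|]normrN slope_norm.
have cont : continuous (slope x : E -> R^o).
  pose m := GRing.isLinear.Build R E R^o *:%R (slope x) lin.
  pose g : {linear E -> R^o} := HB.pack (slope x) m.
  apply: (@linear_bounded_continuous _ _ _ g).1 => //.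
  apply/linear_boundedP; near=> M => v; apply: le_trans (slope_abs v) _.
  by rewrite ler_peMl//; near: M; exact: nbhs_pinfty_ge.
have inP : (slope x : E -> R^o) \in @continuous_functional R E by apply/asboolP.
have fx : slope x x = `|x|.
  apply/eqP; rewrite eq_le slope_norm/=; apply: slope_ge => t t0.
  rewrite ler_pdivlMr// -[x in X in X + _ *: _]scale1r -scalerDl normrZ.
  rewrite gtr0_norm ?addr_gt0// mulrDl mul1r [t * _]mulrC; lra.
exists (DualSpace inP) => //; apply/eqP; rewrite eq_le; apply/andP; split.
  by apply: dual_norm_le => v; apply: le_trans; exact: slope_abs.
have := pairing_le x (DualSpace inP).
by rewrite {1}/pairing/= fx ler_pMr.
Unshelve. all: by end_near. Qed.

Lemma duality_set_neq0 x : exists f, duality_set x f.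
Proof.
have [->|x0] := eqVneq x 0.
  by exists 0; apply/duality_setP; rewrite pairing0l !normr0 expr0n.
have [f fx f1] := norming_functional x0.
exists (`|x| *: f); apply/duality_setP.
by rewrite pairingZr normrZ normr_id fx f1 mulr1 expr2.
Qed.

(* For [f], [g] in the duality sets of [x], [y] and small [w], bound
   [f (x + w) + g (x - w)] by the norms and use smoothness at [x]. *)
Lemma duality_set_close x (e : R) : x != 0 -> 0 < e ->
  exists2 d : R, 0 < d & forall y f g, duality_set x f -> duality_set y g ->
    `|x - y| <= d -> `|f - g| <= e.
Proof.
move=> x0 e0; have nx0 : 0 < `|x| by rewrite normr_gt0.
have e'0 : 0 < e / (2 * `|x|) by rewrite divr_gt0// mulr_gt0.
have [d d0 dP] := uniformly_smooth_norm x0 e'0.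
have D0 : 0 < 4 * `|x| + 2 + d by rewrite !addr_gt0// mulr_gt0.
(* The errors in [h1], [h3] and [h4] below add up to the distance of [x] and [y] times
   [4|x| + 2 + d]; [k] keeps this below [e * d / 2], and the smoothness error in [h2] takes the
   other half. *)
pose k := e * d / (2 * (4 * `|x| + 2 + d)).
have k0 : 0 < k by rewrite !mulr_gt0// invr_gt0 mulr_gt0.
exists (Num.min 1 k); first by rewrite lt_min ltr01.
move=> y f g /duality_setP[fx nf] /duality_setP[gy ng].
rewrite le_min => /andP[xy1 xyk].
apply: ler_dual_norm => v v1; rewrite -(ler_pM2l d0) -pairingZl.
set w := d *: v; have wd : `|w| <= d.
  by rewrite normrZ gtr0_norm// ler_piMr// ltW.
have fw : pairing (x + w) f <= `|x + w| * `|x| by rewrite -nf pairing_le.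
have gw : pairing (x - w) g <= `|x - w| * `|y| by rewrite -ng pairing_le.
have gxy : pairing (y - x) g <= `|x - y| * `|y| by rewrite -ng distrC pairing_le.
have := dP w wd; move: fw gw gxy.
rewrite pairingDl !pairingBl pairingBr fx gy => fw gw gxy sm.
have xyn : `| `|x| - `|y| | <= `|x - y| by exact: ler_dist_dist.
have Yd : `|x - w| <= `|x| + d by rewrite (le_trans (ler_normB _ _))// lerD2l.
have yx1 : `|y| <= `|x| + 1 by move: xyn; rewrite ler_norml; lra.
have xy : `|x| - `|y| <= `|x - y| := le_trans (ler_norm _) xyn.
have yx : `|y| - `|x| <= `|x - y|.
  by apply: le_trans xyn; rewrite distrC ler_norm.
have xyk' : `|x - y| * (4 * `|x| + 2 + d) <= e * d / 2.
  by move: xyk; rewrite /k invfM mulrA ler_pdivlMr.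
have h1 : `|x - w| * (`|y| - `|x|) <= (`|x| + d) * `|x - y|.
  apply: le_trans (ler_wpM2l (normr_ge0 _) yx) _.
  exact: ler_wpM2r.
have h2 : `|x| * (`|x + w| + `|x - w|) <= 2 * `|x| ^+ 2 + e * d / 2.
  apply: le_trans (ler_wpM2l (ltW nx0) sm) _.
  have -> : `|x| * (2 * `|x| + e / (2 * `|x|) * `|w|) =
      2 * `|x| ^+ 2 + e / 2 * `|w| by field; rewrite gt_eqF.
  by rewrite lerD2l mulrAC ler_pM2r// ler_pM2l.
have h3 : (`|x| - `|y|) * (`|x| + `|y|) <= `|x - y| * (2 * `|x| + 1).
  apply: (@le_trans _ _ (`|x - y| * (`|x| + `|y|))).
    by rewrite ler_wpM2r ?addr_ge0.
  by rewrite ler_wpM2l//; lra.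
have h4 : `|x - y| * `|y| <= `|x - y| * (`|x| + 1) by rewrite ler_wpM2l.
lra.
Qed.

End Smoothness.

(** * Half-spaces, limits of pairings and minimization on convex sets *)

Lemma closed_halfspace (R : realType) (E : normedModType R) (f : dualSpace E) (c : R) :
  closed [set v : E | pairing v f <= c].
Proof.
apply: (@closed_comp _ _ (fun v => pairing v f) [set x : R | x <= c]).
  by move=> v _; exact: dualSpace_continuous.
exact: closed_le.
Qed.

Lemma convex_setP (R : realType) (V : lmodType R) (A : set V) :
  convex_set (A : set (convex_lmodType V)) <->
  forall (x y : V) (t : R), 0 <= t -> t <= 1 -> A x -> A y ->
    A (t *: x + (1 - t) *: y).
Proof.
split=> [cA x y t t0 t1 Ax Ay|cA x y l /set_mem Ax /set_mem Ay].
  have := cA x y (Itv01 t0 t1) (mem_set Ax) (mem_set Ay).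
  by move=> /set_mem.
by apply: mem_set; apply: cA.
Qed.

Lemma cvg_pairing (R : realType) (E : normedModType R) (T : Type)
    (F : set_system T) (FF : Filter F) (u : T -> E) (g : T -> dualSpace E)
    (x : E) (f : dualSpace E) :
  u @ F --> x -> g @ F --> f -> (fun t => pairing (u t) (g t)) @ F --> pairing x f.
Proof.
move=> ux gf.
have -> : (fun t => pairing (u t) (g t)) =
    (fun t => pairing (u t) (g t - f) + pairing (u t) f).
  by apply/funext => t; rewrite pairingBr subrK.
rewrite -[pairing x f]add0r; apply: cvgD; last first.
  exact: (cvg_comp _ _ ux (@dualSpace_continuous _ _ f x)).
apply/norm_cvg0P; pose b t : R := `|u t| * `|g t - f|.
apply: (@squeeze_cvgr _ _ _ _ (fun=> 0) b) => /=.
- apply: nearW => t; rewrite normr_ge0/=; exact: (pairing_norm_le (u t) (g t - f)).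
- exact: cvg_cst.
rewrite -(mulr0 `|x|) -[X in _ * X](normr0 (dualSpace E)) -(subrr f).
by apply: cvgM; apply: cvg_norm => //; apply: cvgB => //; exact: cvg_cst.
Qed.

Section Minimization.
Context {R : realType} {E : completeNormedModType R}.
Hypothesis uc : uniformly_convex E.

Lemma sqr_norm_functional_min (K : set E) (f : dualSpace E) :
  K !=set0 -> closed K -> convex_set (K : set (convex_lmodType E)) ->
  exists2 p, K p & forall y, K y ->
    `|p| ^+ 2 - 2 * pairing p f <= `|y| ^+ 2 - 2 * pairing y f.
Proof.
move=> K0 Kcl /convex_setP Kco.
pose g y : R := `|y| ^+ 2 - 2 * pairing y f.
have g_lb y : - `|f| ^+ 2 <= g y.
  by have := pairing_le y f; have := sqr_ge0 (`|y| - `|f|); rewrite /g; nra.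
pose i := inf (g @` K).
have gK : has_inf (g @` K).
  split; first by have [y Ky] := K0; exists (g y), y.
  by exists (- `|f| ^+ 2) => _ [y _ <-].
have i_le y : K y -> i <= g y by move=> Ky; apply: ge_inf; [exact: gK.2|exists y].
have /choice[u uP] n : exists y, K y /\ g y < i + n.+1%:R^-1.
  have n0 : 0 < n.+1%:R^-1 :> R by rewrite invr_gt0.
  by have [_ [y Ky <-] gy] := inf_adherent n0 gK; exists y.
(* Beyond radius [M] the quadratic growth of [g] exceeds [i + 1], so the minimizing sequence is
   bounded. *)
pose M := 2 * `|f| + `|i| + 2.
have uM n : `|u n| <= M.
  rewrite leNgt; apply/negP => Mu; have := (uP n).2.
  have n1 : n.+1%:R^-1 <= 1 :> R by rewrite invf_le1// ler1n.
  have := pairing_le (u n) f; have := ler_norm i; have := normr_ge0 i.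
  have := normr_ge0 f; move: Mu n1.
  rewrite /M /g; move: n.+1%:R^-1 (`|u n|) (pairing _ _) (`|f|) (`|i|).
  move=> k a b c d Mu n1 c0 d0 id bac.
  have : 0 <= a * (a - 2 * c - d - 2) by rewrite mulr_ge0; lra.
  have : 0 <= (a - 2) * (d + 2) by rewrite mulr_ge0; lra.
  rewrite ltNge => h1 h2 /negP; apply; lra.
have cu : cauchy (u @ \oo).
  apply: cauchy_exP => e e0; have [d d0 dP] := uniformly_convex_sqr uc M e0.
  have /cvgrPdist_lt/(_ _ d0)[N _ NP] := @cvg_harmonic R.
  have lt_d n : (N <= n)%N -> g (u n) < i + d.
    move=> Nn; apply: lt_trans (uP n).2 _; rewrite ltrD2l.
    by have := NP n Nn; rewrite /= sub0r normrN ger0_norm.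
  (* Two near-minimizers at distance at least [e] would have a midpoint, still in [K], with value
     below [i]. *)
  exists (u N), N => // n Nn; rewrite /= -ball_normE/= ltNge; apply/negP => far.
  have := dP _ _ (uM N) (uM n) far.
  have Km : K (2^-1 *: (u N + u n)).
    have -> : 2^-1 *: (u N + u n) = 2^-1 *: u N + (1 - 2^-1) *: u n.
      by rewrite scalerDr; congr (_ + _ *: _); field.
    by apply: Kco; [| |exact: (uP N).1|exact: (uP n).1]; lra.
  have := i_le _ Km; have := lt_d _ (leqnn N); have := lt_d _ Nn.
  rewrite /g pairingZl pairingDl; lra.
have /cvg_ex[p up] : cvg (u @ \oo) by exact/cauchy_cvgP.
have Kp : K p.
  by apply: closed_cvg Kcl _ _ up; apply: nearW => n; exact: (uP n).1.
exists p => // y Ky; apply: le_trans (i_le y Ky).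
have gu : g (u n) @[n --> \oo] --> g p.
  apply: cvgB; first by rewrite expr2; apply: cvgM; exact: cvg_norm.
  apply: cvgM; first exact: cvg_cst.
  by apply: cvg_pairing => //; exact: cvg_cst.
have iu : i + n.+1%:R^-1 @[n --> \oo] --> i.
  by rewrite -[X in _ --> X]addr0; apply: cvgD; [exact: cvg_cst|exact: cvg_harmonic].
by apply: ler_cvg_to gu iu _; apply: nearW => n; rewrite ltW// (uP n).2.
Qed.

End Minimization.

(** * The duality map and the generalized projection *)

Section DualityMap.
Context {R : realType} {E : completeNormedModType R}.
Hypotheses (uc : uniformly_convex E) (smooth : uniformly_smooth E).
Implicit Types (x y p : E) (f g : dualSpace E) (K : set E).

Lemma duality_set_J x : duality_set x (J x).
Proof. exact: getPex (duality_set_neq0 smooth x). Qed.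

Lemma pairing_J x : pairing x (J x) = `|x| ^+ 2.
Proof. by have /duality_setP[] := duality_set_J x. Qed.

Lemma norm_J x : `|J x| = `|x|.
Proof. by have /duality_setP[] := duality_set_J x. Qed.

(** Away from 0, the closeness estimate at coinciding points puts any two elements of the duality
    set within every [e]. *)
Lemma duality_set_eq x f : duality_set x f -> J x = f.
Proof.
have [->|x0] := eqVneq x 0.
  move=> /duality_setP[_]; rewrite normr0 => /normr0_eq0 ->.
  by apply: normr0_eq0; rewrite norm_J normr0.
move=> xf; apply/eqP; rewrite -subr_eq0 -normr_le0; apply/ler_addgt0Pr => e e0.
have [d d0 dP] := duality_set_close smooth x0 e0.
rewrite add0r; apply: (dP x) => //; first exact: duality_set_J.
by rewrite subrr normr0 ltW.
Qed.

Lemma J_continuous : continuous (@J R E).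
Proof.
move=> x; apply/cvgrPdist_le => e e0; have [->|x0] := eqVneq x 0.
  have -> : J (0 : E) = 0 by apply: normr0_eq0; rewrite norm_J normr0.
  near=> y; rewrite sub0r normrN norm_J -[y]opprK normrN -sub0r.
  by near: y; exact: cvgr_dist_le.
have [d d0 dP] := duality_set_close smooth x0 e0.
near=> y; apply: (dP y); [exact: duality_set_J..|].
by near: y; exact: cvgr_dist_le.
Unshelve. all: by end_near. Qed.

Lemma phi_three_point x y p :
  phi y x = phi y p + phi p x + 2 * pairing (y - p) (J p - J x).
Proof. by rewrite /phi pairingBr !pairingBl pairing_J; ring. Qed.

Lemma phi_sym_sum x y : phi x y + phi y x = 2 * pairing (x - y) (J x - J y).
Proof. by rewrite /phi pairingBr !pairingBl !pairing_J; ring. Qed.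

Lemma phi_ge_sqr x y : (`|x| - `|y|) ^+ 2 <= phi x y.
Proof. by have := pairing_le x (J y); rewrite norm_J /phi; lra. Qed.

Lemma phi_ge0 x y : 0 <= phi x y.
Proof. exact: le_trans (sqr_ge0 _) (phi_ge_sqr x y). Qed.

(** If [x] and [y] were far apart, their midpoint [m] would satisfy
    [phi m y <= phi x y / 2 - d < 0]. A bound on the smaller norm suffices because [phi x y < 1]
    forces the norms to differ by less than 1. *)
Lemma phi_small (M e : R) : 0 < e -> exists2 d : R, 0 < d &
  forall x y, Num.min `|x| `|y| <= M -> phi x y < d -> `|x - y| < e.
Proof.
move=> e0; have [d d0 dP] := uniformly_convex_sqr uc (M + 1) e0.
exists (Num.min 1 d); first by rewrite lt_min ltr01.
move=> x y mM; rewrite lt_min => /andP[xy1 xyd].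
have : (`|x| - `|y|) ^+ 2 < 1 := le_lt_trans (phi_ge_sqr x y) xy1.
rewrite -[ltRHS](expr1n _ 2) -real_normK ?num_real// ltr_pXn2r ?nnegrE//.
rewrite ltr_norml => nxy.
have [xM yM] : `|x| <= M + 1 /\ `|y| <= M + 1.
  by move: mM; rewrite ge_min => /orP[] ?; split; lra.
rewrite ltNge; apply/negP => /(dP _ _ xM yM).
have := phi_ge0 (2^-1 *: (x + y)) y.
rewrite /phi pairingZl pairingDl pairing_J => h1 h2.
by move: xyd; rewrite ltNge => /negP; apply; rewrite /phi; lra.
Qed.

Lemma phi_le0_eq x y : phi x y <= 0 -> x = y.
Proof.
move=> xy; apply/eqP; rewrite -subr_eq0 -normr_le0; apply/ler_addgt0Pr => e e0.
have [d d0 dP] := phi_small `|x| e0.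
rewrite add0r ltW// dP//; first by rewrite ge_min lexx.
exact: le_lt_trans xy d0.
Qed.

Lemma phi_cvg0_dist (T : Type) (F : set_system T) (FF : Filter F)
    (u v : T -> E) (M : R) : (\forall t \near F, Num.min `|u t| `|v t| <= M) ->
  phi (u t) (v t) @[t --> F] --> (0 : R) -> u t - v t @[t --> F] --> (0 : E).
Proof.
move=> uvM /cvgrPdist_lt uv; apply/cvgr0Pnorm_lt => e e0.
have [d d0 dP] := phi_small M e0; near=> t; apply: dP; first by near: t.
have : `|0 - phi (u t) (v t)| < d by near: t; exact: uv.
by rewrite sub0r normrN; apply: le_lt_trans; exact: ler_norm.
Unshelve. all: by end_near. Qed.

Lemma phi_cvg0r (T : Type) (F : set_system T) (FF : Filter F) (u v : T -> E) p :
  u @ F --> p -> phi (u t) (v t) @[t --> F] --> (0 : R) -> v @ F --> p.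
Proof.
move=> up uv; have -> : v = (fun t => u t - (u t - v t)).
  by apply/funext => t; rewrite subKr.
rewrite -[p]subr0; apply: cvgB => //; apply: (@phi_cvg0_dist _ _ _ _ _ (`|p| + 1)) => //.
near=> t; rewrite ge_min ltW//; near: t; apply: (cvgr_norm_lt p) => //.
by rewrite ltrDl.
Unshelve. all: by end_near. Qed.

Lemma phi_cvg0l (T : Type) (F : set_system T) (FF : Filter F) (u v : T -> E) p :
  v @ F --> p -> phi (u t) (v t) @[t --> F] --> (0 : R) -> u @ F --> p.
Proof.
move=> vp uv; have -> : u = (fun t => (u t - v t) + v t).
  by apply/funext => t; rewrite subrK.
rewrite -[p]add0r; apply: cvgD => //; apply: (@phi_cvg0_dist _ _ _ _ _ (`|p| + 1)) => //.
near=> t; rewrite ge_min orbC ltW//; near: t; apply: (cvgr_norm_lt p) => //.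
by rewrite ltrDl.
Unshelve. all: by end_near. Qed.

Lemma cvg_phi (T : Type) (F : set_system T) (FF : Filter F) (u v : T -> E) p q :
  u @ F --> p -> v @ F --> q -> phi (u t) (v t) @[t --> F] --> phi p q.
Proof.
move=> up vq; apply: cvgD; last by rewrite expr2; apply: cvgM; exact: cvg_norm.
apply: cvgB; first by rewrite expr2; apply: cvgM; exact: cvg_norm.
apply: cvgM; first exact: cvg_cst.
by apply: cvg_pairing => //; apply: (cvg_comp _ _ vq); exact: J_continuous.
Qed.

Lemma phixx x : phi x x = 0.
Proof. by rewrite /phi pairing_J; ring. Qed.

Lemma J_inj : injective (@J R E).
Proof.
move=> x y xy; apply: phi_le0_eq.
have nxy : `|x| = `|y| by rewrite -norm_J xy norm_J.
by rewrite /phi -xy pairing_J nxy; lra.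
Qed.

Lemma J_surj f : exists x, J x = f.
Proof.
have T0 : [set: E] !=set0 by exists 0.
have Tco : convex_set ([set: E] : set (convex_lmodType E)) by exact/convex_setP.
have [p _ pP] := sqr_norm_functional_min uc f T0 closedT Tco.
have {}pP y : `|p| ^+ 2 - 2 * pairing p f <= `|y| ^+ 2 - 2 * pairing y f by exact: pP.
have fp : pairing p f = `|p| ^+ 2.
  have [->|p0] := eqVneq p 0; first by rewrite pairing0l normr0 expr0n.
  have np0 : 0 < `|p| ^+ 2 by rewrite exprn_gt0// normr_gt0.
  (* This multiple of [p] is the minimizer on the line through [p]; comparing values forces the
     pairing to be the squared norm. *)
  have := pP ((pairing p f / `|p| ^+ 2) *: p).
  rewrite normrZ exprMn real_normK ?num_real// pairingZl.
  have -> : (pairing p f / `|p| ^+ 2) ^+ 2 * `|p| ^+ 2 -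
      2 * (pairing p f / `|p| ^+ 2 * pairing p f) = - (pairing p f ^+ 2 / `|p| ^+ 2).
    by field; rewrite normr_eq0.
  rewrite lerNr ler_pdivrMr// => h.
  apply/eqP; rewrite -subr_eq0 -sqrf_eq0 eq_le sqr_ge0 andbT.
  by move: h; move: (pairing p f) (`|p| ^+ 2) => a b; nra.
exists p; apply: duality_set_eq; apply/duality_setP; split => //.
apply/eqP; rewrite eq_le; apply/andP; split; last first.
  have [->|p0] := eqVneq p 0; first by rewrite normr0.
  have np0 : 0 < `|p| by rewrite normr_gt0.
  by have := pairing_le p f; rewrite fp expr2 ler_pM2l.
(* For [v] in the unit ball, the test vector [f(v) v] has value at most [- f(v)^2], whereas the
   minimum is minus the squared norm of [p]. *)
apply: ler_dual_norm => v v1; have := pP (pairing v f *: v).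
rewrite fp normrZ exprMn real_normK ?num_real// pairingZl => h.
have v2 : pairing v f ^+ 2 * `|v| ^+ 2 <= pairing v f ^+ 2.
  by rewrite ler_piMr ?sqr_ge0// expr_le1.
apply: le_trans (ler_norm _) _; rewrite -ler_sqr ?nnegrE// real_normK ?num_real//.
lra.
Qed.

Lemma JinvK f : J (Jinv f) = f.
Proof. exact: getPex (J_surj f). Qed.

Lemma JK x : Jinv (J x) = x.
Proof. by apply: J_inj; rewrite JinvK. Qed.

Lemma norm_Jinv f : `|Jinv f| = `|f|.
Proof. by rewrite -norm_J JinvK. Qed.

(** The symmetrized [phi] is a pairing of differences, at most [2 (|f| + |g|) |f - g|] at the two
    preimages; small [phi] then gives convergence. *)
Lemma Jinv_continuous : continuous (@Jinv R E).
Proof.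
move=> f; apply: (@phi_cvg0r _ (nbhs f) _ (fun=> Jinv f)); first exact: cvg_cst.
pose b g : R := 2 * ((`|f| + `|g|) * `|f - g|).
apply: (@squeeze_cvgr _ (nbhs f) _ R (fun=> 0) b).
- apply: nearW => g; rewrite phi_ge0/=.
  apply: (@le_trans _ _ (phi (Jinv f) (Jinv g) + phi (Jinv g) (Jinv f))).
    by rewrite lerDl phi_ge0.
  rewrite phi_sym_sum !JinvK ler_pM2l// (le_trans (pairing_le _ _))//.
  by rewrite ler_wpM2r// (le_trans (ler_normB _ _))// !norm_Jinv.
- exact: cvg_cst.
rewrite -[X in _ --> X](mulr0 2) -[X in 2 * X](mulr0 (`|f| + `|f|)).
rewrite -[X in _ * (_ * X)](normr0 (dualSpace E)) -(subrr f).
apply: cvgM; first exact: cvg_cst.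
apply: cvgM; first by apply: cvgD; [exact: cvg_cst|exact: cvg_norm].
by apply: cvg_norm; apply: cvgB; [exact: cvg_cst|exact: cvg_id].
Qed.

Lemma phi_Jinv x f : phi x (Jinv f) = `|x| ^+ 2 - 2 * pairing x f + `|f| ^+ 2.
Proof. by rewrite /phi JinvK norm_Jinv. Qed.

(** In the dual variable, [phi] is an affine function plus the squared dual norm. *)
Lemma phi_Jinv_convex x f1 f2 f3 (a1 a2 a3 : R) :
  0 <= a1 -> 0 <= a2 -> 0 <= a3 -> a1 + a2 + a3 = 1 ->
  phi x (Jinv (a1 *: f1 + a2 *: f2 + a3 *: f3)) <=
    a1 * phi x (Jinv f1) + a2 * phi x (Jinv f2) + a3 * phi x (Jinv f3).
Proof.
move=> a10 a20 a30 a1E; rewrite !phi_Jinv !pairingDr !pairingZr.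
have nf : `|a1 *: f1 + a2 *: f2 + a3 *: f3| <= a1 * `|f1| + a2 * `|f2| + a3 * `|f3|.
  by rewrite (le_trans (ler_normD _ _))// lerD ?(le_trans (ler_normD _ _))//
    ?lerD// normrZ ger0_norm.
have -> : a1 * (`|x| ^+ 2 - 2 * pairing x f1 + `|f1| ^+ 2) +
    a2 * (`|x| ^+ 2 - 2 * pairing x f2 + `|f2| ^+ 2) +
    a3 * (`|x| ^+ 2 - 2 * pairing x f3 + `|f3| ^+ 2) =
    (a1 + a2 + a3) * `|x| ^+ 2 -
    2 * (a1 * pairing x f1 + a2 * pairing x f2 + a3 * pairing x f3) +
    (a1 * `|f1| ^+ 2 + a2 * `|f2| ^+ 2 + a3 * `|f3| ^+ 2) by ring.
rewrite a1E mul1r lerD2l (le_trans _ (sqr_convex3 _ _ _ a10 a20 a30 a1E))//.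
by rewrite ler_sqr ?nnegrE// (le_trans _ nf).
Qed.

Lemma gproj_exists K x : K !=set0 -> closed K ->
  convex_set (K : set (convex_lmodType E)) ->
  exists2 p, K p & forall y, K y -> phi p x <= phi y x.
Proof.
move=> K0 Kcl Kco; have [p Kp pP] := sqr_norm_functional_min uc (J x) K0 Kcl Kco.
by exists p => // y Ky; rewrite /phi lerD2r pP.
Qed.

(** The three-point identity is expanded at [q t], a point moved from [p] towards [y], so that the
    extra [phi] term has the favourable sign; continuity of [J] handles [t -> 0]. *)
Lemma phi_min_variational K x p : convex_set (K : set (convex_lmodType E)) ->
  K p -> (forall y, K y -> phi p x <= phi y x) ->
  forall y, K y -> pairing (y - p) (J x - J p) <= 0.
Proof.
move=> /convex_setP Kco Kp pP y Ky.
pose q (t : R) := t *: y + (1 - t) *: p.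
have qp : q t @[t --> 0^'+] --> p.
  apply: cvg_at_right_filter; rewrite -[X in _ --> X](scale1r p).
  rewrite -[X in _ --> X]add0r -(scale0r y) -[in X in _ --> X](subr0 1).
  apply: cvgD; apply: cvgZl => //; apply: cvgB => //; exact: cvg_cst.
have lim : pairing (y - p) (J x - J (q t)) @[t --> 0^'+] -->
    pairing (y - p) (J x - J p).
  apply: cvg_pairing; first exact: cvg_cst.
  apply: cvgB; first exact: cvg_cst.
  by apply: (cvg_comp _ _ qp); exact: J_continuous.
apply: (cvgr_to_le lim); near=> t.
have t0 : 0 < t by near: t; exact: nbhs_right_gt.
have t1 : t <= 1 by near: t; exact: nbhs_right_le.
have := pP _ (Kco y p t (ltW t0) t1 Ky Kp); rewrite -/(q t).
rewrite (phi_three_point x p (q t)); have := phi_ge0 p (q t).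
have -> : p - q t = - (t *: (y - p)).
  rewrite /q scalerBl scale1r scalerBr opprB opprD opprB.
  by rewrite [- (t *: y) + _]addrC addrA subrKC.
rewrite pairingNl pairingZl -[J (q t) - J x]opprB pairingNr => h1 h2.
have : t * pairing (y - p) (J x - J (q t)) <= 0 by lra.
by rewrite pmulr_rle0.
Unshelve. all: by end_near. Qed.

(** This form of the three-point identity serves the projections and both kinds of resolvents. *)
Lemma variational_phi x p y : pairing (y - p) (J x - J p) <= 0 ->
  phi y p + phi p x <= phi y x.
Proof.
rewrite (phi_three_point x y p) -(opprB (J p)) pairingNr; lra.
Qed.

Lemma gprojP K x : K !=set0 -> closed K ->
  convex_set (K : set (convex_lmodType E)) ->
  K (gproj K x) /\
  forall y, K y -> pairing (y - gproj K x) (J x - J (gproj K x)) <= 0.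
Proof.
move=> K0 Kcl Kco; have [p Kp pP] := gproj_exists x K0 Kcl Kco.
have [Kg gE] : K (gproj K x) /\ phi (gproj K x) x = inf [set phi y x | y in K].
  apply: (@getPex _ [set p | K p /\ phi p x = inf [set phi y x | y in K]]).
  exists p; split => //; apply/eqP; rewrite eq_le; apply/andP; split.
    apply: lb_le_inf; first by exists (phi p x), p.
    by move=> _ [y Ky <-]; exact: pP.
  apply: ge_inf; last by exists p.
  by exists 0 => _ [y _ <-]; exact: phi_ge0.
split => //; apply: phi_min_variational => // y Ky; rewrite gE.
apply: ge_inf; last by exists y.
by exists 0 => _ [z _ <-]; exact: phi_ge0.
Qed.

(** Adding the two variational inequalities, each tested at the other point, makes the symmetrized
    [phi] nonpositive. *)
Lemma gproj_unique K x p : K !=set0 -> closed K ->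
  convex_set (K : set (convex_lmodType E)) -> K p ->
  (forall y, K y -> pairing (y - p) (J x - J p) <= 0) -> p = gproj K x.
Proof.
move=> K0 Kcl Kco Kp pP; have [Kg gP] := gprojP x K0 Kcl Kco.
have := variational_phi (pP _ Kg); have := variational_phi (gP _ Kp).
have := phi_ge0 p (gproj K x) => h1 h2 h3.
by apply: esym; apply: phi_le0_eq; lra.
Qed.

End DualityMap.

(** * Limits of resolvents *)

(** Every value of [mu] and [nu] recurs, so it is met in each tail; this replaces the extraction of
    subsequences. *)
Lemma infinite_set_near (S P : set nat) : infinite_set S ->
  (\forall n \near \oo, P n) -> exists2 n, S n & P n.
Proof.
move=> Sinf [N _ NP]; apply: contrapT => SP; apply: Sinf.
apply: (@sub_finite_set _ _ `I_N); last exact: finite_II.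
move=> n Sn /=; rewrite ltnNge; apply/negP => Nn.
by apply: SP; exists n => //; exact: NP.
Qed.

Section Limits.
Context {R : realType} {E : completeNormedModType R}.
Hypothesis smooth : uniformly_smooth E.
Variables (C : set E) (z s : nat -> E) (p : E) (r : nat -> R) (a : R).
Hypotheses (a0 : 0 < a) (ar : forall n, a <= r n).
Hypotheses (Cz : forall n, C (z n)) (Cp : C p).
Hypotheses (zp : z @ \oo --> p) (sp : s @ \oo --> p).

(** The regularization term of the resolvent inequalities. *)
Let error y n : R := (r n)^-1 * pairing (y - z n) (J (z n) - J (s n)).

Lemma resolvent_error_cvg0 y : error y @ \oo --> (0 : R).
Proof.
pose b n : R := a^-1 * `|pairing (y - z n) (J (z n) - J (s n))|.
apply/norm_cvg0P; apply: (@squeeze_cvgr _ _ _ _ (fun=> 0) b).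
- apply: nearW => n; rewrite normr_ge0 /error normrM ler_wpM2r//.
  have r0 : 0 < r n := lt_le_trans a0 (ar n).
  by rewrite gtr0_norm ?invr_gt0// lef_pV2.
- exact: cvg_cst.
rewrite -[X in _ --> X](mulr0 a^-1); apply: cvgM; first exact: cvg_cst.
rewrite -[X in _ --> X](normr0 R) -(subrr (pairing (y - p) (J p))) -pairingBr.
apply: cvg_norm; apply: cvg_pairing; first by apply: cvgB => //; exact: cvg_cst.
by apply: cvgB; [apply: (cvg_comp _ _ zp)|apply: (cvg_comp _ _ sp)];
  exact: J_continuous.
Qed.

(** Monotonicity and lower semicontinuity first give the dual inequality [f (J y) (J p) <= 0].
    Minty's argument then tests it on the segment from [J p] to [J y], which stays in [JC], and (A3)
    returns to [J p]. *)
Lemma EP_limit (f : dualSpace E -> dualSpace E -> R) (S : set nat) :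
  convex_set (@J R E @` C : set (convex_lmodType (dualSpace E))) ->
  bifun_conditions (@J R E @` C) f -> infinite_set S ->
  (forall n y, S n -> C y -> 0 <= f (J (z n)) (J y) + error y n) -> EP C f p.
Proof.
move=> /convex_setP JCco [A1 A2 A3 A4] Sinf fz.
have JC y : C y -> (@J R E @` C) (J y) by move=> Cy; exists y.
have Jz : J (z n) @[n --> \oo] --> J p.
  by apply: (cvg_comp _ _ zp); exact: J_continuous.
have fp y : C y -> f (J y) (J p) <= 0.
  move=> Cy; rewrite leNgt; apply/negP => c0.
  have c20 : 0 < f (J y) (J p) / 2 by rewrite divr_gt0.
  have [_ lsc] := A4 _ (JC _ Cy).
  have [V] := lsc (J p) (f (J y) (J p) / 2) ltac:(by rewrite lte_fin; lra).
  move=> pV Vf.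
  (* Semicontinuity is relative to [JC], so [V] contains the late [J (z n)] because these lie in
     [JC]. *)
  have {}pV : within (@J R E @` C) (nbhs (J p)) V.
    by rewrite nbhs_subspace_in//; exact: JC.
  have VJz : \forall n \near \oo, V (J (z n)).
    have : \forall n \near \oo, (@J R E @` C) (J (z n)) -> V (J (z n)) := Jz _ pV.
    by apply: filterS => n; apply; exact: JC (Cz n).
  have /cvgrPdist_lt/(_ _ c20) := resolvent_error_cvg0 y.
  move=> /(filterI VJz)/(infinite_set_near Sinf)[n Sn [Vn]].
  rewrite sub0r normrN => /(le_lt_trans (ler_norm _)) en.
  have := fz n y Sn Cy; have := Vf _ Vn; rewrite lte_fin.
  have := A2 _ _ (JC _ (Cz n)) (JC _ Cy); lra.
split=> // y Cy; rewrite -lee_fin; apply: le_trans (A3 _ _ _ (JC _ Cp) (JC _ Cy) (JC _ Cy)).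
(* The upper limit is an infimum of suprema, so one [t] with a nonnegative value in each
   neighbourhood is enough. *)
rewrite limf_esupE; apply: le_ereal_inf_tmp => _ [V [d /= d0 dV] <-].
pose t := Num.min (d / 2) (2^-1).
have t0 : 0 < t by rewrite lt_min divr_gt0//= invr_gt0.
have td : t < d by rewrite gt_min ltr_pdivrMr// mulr_natr mulr2n ltrDl d0.
have t1 : t < 1 by rewrite gt_min invf_lt1 ?ltr1n ?orbT.
apply: (@le_trans _ _ (f (t *: J y + (1 - t) *: J p) (J y))%:E); last first.
  apply: ereal_sup_ubound; exists t => //; apply: dV => //=.
  by rewrite sub0r normrN gtr0_norm.
set w := _ + _; have Jw : (@J R E @` C) w by apply: JCco; [exact: ltW|exact: ltW|exact: JC..].
have [v Cv vw] := Jw.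
have [fco _] := A4 _ Jw.
have := fco (Itv01 (ltW t0) (ltW t1)) (J y) (J p) (mem_set (JC _ Cy)) (mem_set (JC _ Cp)).
rewrite convRE /= -[f w _]/(f w w) A1//.
have := fp v Cv; rewrite vw => fwp h; rewrite lee_fin.
have t'0 : 0 <= 1 - t by rewrite subr_ge0 ltW.
have := mulr_ge0_le0 t'0 fwp => h'.
rewrite -(pmulr_rge0 _ t0). move: h; rewrite /unstable.onem; lra.
Qed.

(** Continuity of [A] along [C] makes the whole left-hand side converge; a negative limit would
    contradict the inequality at a late index of [S]. *)
Lemma VI_limit (A : E -> dualSpace E) (S : set nat) :
  {within C, continuous A} -> infinite_set S ->
  (forall n y, S n -> C y -> 0 <= pairing (y - z n) (A (z n)) + error y n) ->
  VI C A p.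
Proof.
move=> /subspace_continuousP cA Sinf Az; split=> // y Cy.
have Azp : A (z n) @[n --> \oo] --> A p.
  move=> W /(cA p Cp) pW.
  have {}pW : nbhs p [set v | C v -> W (A v)] by exact: pW.
  have : \forall n \near \oo, C (z n) -> W (A (z n)) := zp pW.
  by apply: filterS => n; apply.
rewrite leNgt; apply/negP => c0.
have lim : pairing (y - z n) (A (z n)) + error y n @[n --> \oo] --> pairing (y - p) (A p).
  rewrite -[X in _ --> X]addr0; apply: cvgD; last exact: resolvent_error_cvg0.
  by apply: cvg_pairing => //; apply: cvgB => //; exact: cvg_cst.
have [n Sn] := infinite_set_near Sinf (cvgr_lt _ lim _ c0).
by rewrite ltNge Az.
Qed.

End Limits.

(** * Strong convergence *)

(** Indices start at 0: [x 0] and [K 0] are the starting point and [C]. The equalities with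
    singletons express that each resolvent problem has exactly one solution. *)
Theorem corollary4p2 (R : realType) (E : completeNormedModType R)
  (hconv : uniformly_convex E) (hsmooth : uniformly_smooth E)
  (C : set E) (C_neq0 : C !=set0) (C_closed : closed C)
  (C_convex : convex_set (C : set (convex_lmodType E)))
  (JC_closed : closed (@J R E @` C))
  (JC_convex : convex_set (@J R E @` C : set (convex_lmodType (dualSpace E))))
  (f : nat -> dualSpace E -> dualSpace E -> R)
  (f_cond : forall i, bifun_conditions (@J R E @` C) (f i))
  (A : nat -> E -> dualSpace E)
  (A_cont : forall j, {within C, continuous (A j)})
  (A_mono : forall j, monotone_on C (A j))
  (T : nat -> E -> dualSpace E)
  (T_nonexp : forall n, generalized_Jstar_nonexpansive C (T n))
  (Gamma : set (E -> dualSpace E))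
  (Gamma_closed : forall S, Gamma S -> Jstar_closed C S)
  (Gamma_nonexp : forall S, Gamma S -> generalized_Jstar_nonexpansive C S)
  (T_Gamma : \bigcap_n FJ C (T n) = FJ_family C Gamma)
  (Gamma_neq0 : FJ_family C Gamma !=set0)
  (nst : NST_condition C T Gamma)
  (B : set E)
  (B_def : B = FJ_family C Gamma `&` \bigcap_i EP C (f i)
                 `&` \bigcap_j VI C (A j))
  (B_neq0 : B !=set0) (B_closed : closed B)
  (B_convex : convex_set (B : set (convex_lmodType E)))
  (mu nu : nat -> nat)
  (mu_inf : forall i, infinite_set [set n | mu n = i])
  (nu_inf : forall j, infinite_set [set n | nu n = j])
  (h : E -> E) (hC : forall v, C v -> C (h v))
  (rho : R) (rho_gt0 : 0 < rho) (rho_lt1 : rho < 1)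
  (h_contr : forall v w, C v -> C w -> `|h v - h w| <= rho * `|v - w|)
  (ubar : E) (ubarC : C ubar)
  (lambda sigma : nat -> R)
  (lambda_itv : forall n, 0 <= lambda n < 1)
  (sigma_itv : forall n, 0 <= sigma n < 1)
  (lambda_sigma : forall n, lambda n + sigma n < 1)
  (lambda_cvg : lambda @ \oo --> (0 : R)) (sigma_cvg : sigma @ \oo --> (0 : R))
  (alpha1 alpha2 alpha3 : R)
  (alpha1_itv : 0 < alpha1 < 1) (alpha2_itv : 0 < alpha2 < 1)
  (alpha3_itv : 0 < alpha3 < 1) (alpha_sum : alpha1 + alpha2 + alpha3 = 1)
  (a : R) (a_gt0 : 0 < a) (r : nat -> R) (r_ge : forall n, a <= r n)
  (x s z u y : nat -> E) (K : nat -> set E)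
  (x0C : C (x 0%N)) (K0 : K 0%N = C)
  (s_def : forall n, s n = Jinv (lambda n *: J (h (x n)) + sigma n *: J ubar
                                 + (1 - lambda n - sigma n) *: J (x n)))
  (z_def : forall n,
    [set v | C v /\ forall w, C w ->
       0 <= f (mu n) (J v) (J w) + (r n)^-1 * pairing (w - v) (J v - J (s n))]
    = [set z n])
  (u_def : forall n,
    [set v | C v /\ forall w, C w ->
       0 <= pairing (w - v) (A (nu n) v)
            + (r n)^-1 * pairing (w - v) (J v - J (s n))]
    = [set u n])
  (y_def : forall n, y n = Jinv (alpha1 *: J (s n) + alpha2 *: J (z n)
                                 + alpha3 *: T n (u n)))
  (K_def : forall n,
    K n.+1 = [set v | K n v /\ phi v (y n) <= phi v (s n)])
  (x_def : forall n, x n.+1 = gproj (K n.+1) (x 0%N)) :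
  let q := gproj B (x 0%N) in
  [set p | B p /\
     forall p', B p' -> pairing (p' - p) (J (x 0%N) - J p) <= 0] = [set q]
  /\ x @ \oo --> q.
Proof.
move=> q.
have BC p : B p -> C p by rewrite B_def => -[[[]]].
have JC v : C v -> (@J R E @` C) (J v) by exists v.

(* Resolvent inequalities against points of [B] *)
have zP n : C (z n) /\ forall w, C w ->
    0 <= f (mu n) (J (z n)) (J w) + (r n)^-1 * pairing (w - z n) (J (z n) - J (s n)).
  by have : [set z n] (z n) by []; rewrite -z_def.
have uP n : C (u n) /\ forall w, C w ->
    0 <= pairing (w - u n) (A (nu n) (u n)) +
      (r n)^-1 * pairing (w - u n) (J (u n) - J (s n)).
  by have : [set u n] (u n) by []; rewrite -u_def.
have r0 n : 0 < r n := lt_le_trans a_gt0 (r_ge n).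
have phi_z n p : B p -> phi p (z n) + phi (z n) (s n) <= phi p (s n).
  move=> Bp; apply: variational_phi => //.
  (* By (A2) and [p] in [EP], the bifunction term at [p] is nonpositive, so the pairing in the
     resolvent inequality is nonnegative. *)
  have [Cz /(_ p (BC _ Bp))] := zP n.
  move: (Bp); rewrite B_def => -[[_ /(_ (mu n) I)[_ /(_ _ Cz) fp]] _].
  have [_ /(_ (J (z n)) (J p) (JC _ Cz) (JC _ (BC _ Bp))) fzp _ _] := f_cond (mu n).
  rewrite -[J (s n) - _]opprB pairingNr oppr_le0 => fsz.
  rewrite -(pmulr_rge0 _ (_ : 0 < (r n)^-1)) ?invr_gt0//; lra.
have phi_u n p : B p -> phi p (u n) + phi (u n) (s n) <= phi p (s n).
  move=> Bp; apply: variational_phi => //.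
  have [Cu /(_ p (BC _ Bp))] := uP n.
  move: (Bp); rewrite B_def => -[_ /(_ (nu n) I)[_ /(_ _ Cu) Ap]].
  (* Monotonicity replaces the value of the operator at [u n] by that at [p], where the variational
     inequality gives the sign. *)
  have := A_mono (nu n) p (u n) (BC _ Bp) Cu.
  move: Ap; rewrite pairingBr -[u n - p]opprB pairingNl.
  rewrite -[J (s n) - _]opprB pairingNr oppr_le0 => Ap Amono fsu.
  rewrite -(pmulr_rge0 _ (_ : 0 < (r n)^-1)) ?invr_gt0//; lra.
have phi_T n p : B p -> phi p (Jinv (T n (u n))) <= phi p (u n).
  move=> Bp; apply: (T_nonexp n).2; first exact: (uP n).1.
  have : FJ_family C Gamma p by move: Bp; rewrite B_def => -[[]].
  by rewrite -T_Gamma => /(_ n I).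
have [/andP[a10 _] /andP[a20 _] /andP[a30 _]] := And3 alpha1_itv alpha2_itv alpha3_itv.
have phi_y n p : B p ->
    phi p (y n) + alpha2 * phi (z n) (s n) + alpha3 * phi (u n) (s n) <= phi p (s n).
  move=> Bp; rewrite y_def -[T n (u n)](JinvK hconv hsmooth).
  have := phi_Jinv_convex hconv hsmooth p (J (s n)) (J (z n)) (J (Jinv (T n (u n))))
    (ltW a10) (ltW a20) (ltW a30) alpha_sum.
  rewrite !JK//.
  have := ler_wpM2l (ltW a20) (phi_z n p Bp).
  have := ler_wpM2l (ltW a30) (le_trans _ (phi_u n p Bp)).
  move=> /(_ (phi p (Jinv (T n (u n))) + phi (u n) (s n))).
  rewrite lerD2r => /(_ (phi_T n p Bp)).
  have : phi p (s n) = alpha1 * phi p (s n) + alpha2 * phi p (s n) + alpha3 * phi p (s n).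
    by rewrite -!mulrDl alpha_sum mul1r.
  by rewrite !mulrDr; lra.

(* The sets [K n] and the projections onto them *)
have BK n p : B p -> K n p.
  elim: n => [|n IHn] Bp; first by rewrite K0; exact: BC.
  rewrite K_def; split; first exact: IHn.
  apply: le_trans (phi_y n p Bp); rewrite -addrA lerDl addr_ge0//.
    by rewrite mulr_ge0 ?(ltW a20)// phi_ge0.
  by rewrite mulr_ge0 ?(ltW a30)// phi_ge0.
have Kn0 n : K n !=set0 by have [p /(BK n)] := B_neq0; exists p.
(* The squared norm of [v] cancels, leaving an affine condition. *)
have K_halfspace n : K n.+1 = K n `&` [set v |
    pairing v (J (s n) - J (y n)) <= (`|s n| ^+ 2 - `|y n| ^+ 2) / 2].
  rewrite K_def; apply/seteqP; split=> v [Kv vs]; split=> //;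
    by move: vs; rewrite /mkset /phi pairingBr; lra.
have K_closed n : closed (K n).
  elim: n => [|n IHn]; first by rewrite K0.
  by rewrite K_halfspace; apply: closedI => //; exact: closed_halfspace.
have K_convex n : convex_set (K n : set (convex_lmodType E)).
  elim: n => [|n /convex_setP IHn]; first by rewrite K0.
  apply/convex_setP => v w t t0 t1; rewrite K_halfspace => -[Kv vs] [Kw ws].
  split; first exact: IHn.
  by move: vs ws; rewrite /mkset pairingDl !pairingZl; nra.
have K_decr n m : (n <= m)%N -> K m `<=` K n.
  elim: m => [|m IHm]; first by rewrite leqn0 => /eqP ->.
  rewrite leq_eqVlt => /predU1P[-> //|nm]; rewrite K_def => v [Kv _].
  exact: IHm.
have Kproj n := gprojP hconv hsmooth (x 0%N) (Kn0 n) (K_closed n) (K_convex n).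
have Kx n : K n (x n).
  by case: n => [|n]; rewrite ?K0// x_def; exact: (Kproj n.+1).1.
have KC n : K n `<=` C by rewrite -K0; exact: K_decr.
have x_min n v : K n v -> phi v (x n) + phi (x n) (x 0%N) <= phi v (x 0%N).
  (* The starting point is not defined as a projection; there the inequality is an equality. *)
  case: n => [|n] Kv; first by rewrite phixx// addr0.
  apply: variational_phi => //; rewrite x_def.
  exact: (Kproj n.+1).2.

(* Convergence of the iterates *)
have [b0 Bb0] := B_neq0.
pose G n := phi (x n) (x 0%N).
have GL n : G n <= phi b0 (x 0%N).
  by apply: le_trans (x_min n b0 (BK n _ Bb0)); rewrite lerDr phi_ge0.
have x_norm n : `|x n| <= `|x 0%N| + phi b0 (x 0%N) + 1.
  have := GL n; have := phi_ge_sqr hsmooth (x n) (x 0%N); rewrite -/(G n).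
  by move=> /le_trans/[apply]; exact: ler_sqr_dist.
have x_cauchy : cauchy (x @ \oo).
  apply: cauchy_exP => e e0.
  have [d d0 dP] := phi_small hconv hsmooth (`|x 0%N| + phi b0 (x 0%N) + 1) e0.
  have Gsup : has_sup (range G).
    split; first by exists (G 0%N), 0%N.
    by exists (phi b0 (x 0%N)) => _ [n _ <-].
  (* For [n >= N], [phi (x n) (x N) <= G n - G N < d], as [G N] is within [d] of the supremum. *)
  have [_ [N _ <-] GN] := sup_adherent d0 Gsup.
  exists (x N), N => // n /= Nn; rewrite -ball_normE/= distrC; apply: dP.
    by rewrite ge_min x_norm.
  have := x_min N _ (K_decr _ _ Nn _ (Kx n)); rewrite -/(G N) -/(G n).
  have : G n <= sup (range G) by apply: sup_upper_bound => //; exists n.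
  lra.
have /cvg_ex[p xp] : cvg (x @ \oo) by exact/cauchy_cvgP.
have Kp n : K n p.
  apply: closed_cvg (K_closed n) _ _ xp; exists n => // m /= nm.
  exact: K_decr nm _ (Kx m).
have Cp : C p by exact: KC (Kp 0%N).
have cJ (v : nat -> E) w : v @ \oo --> w -> J (v n) @[n --> \oo] --> J w.
  by move=> vw; apply: (cvg_comp _ _ vw); exact: J_continuous.
have cJinv (v : nat -> dualSpace E) w : v @ \oo --> J w -> Jinv (v n) @[n --> \oo] --> w.
  rewrite -{2}(JK hconv hsmooth w) => vw; apply: (cvg_comp _ _ vw).
  exact: Jinv_continuous.

(* Limits of the auxiliary sequences *)
have sp : s @ \oo --> p.
  rewrite (funext s_def); apply: cJinv.
  (* The limit is written with the limiting weights 0, 0 and 1 to pass to the limit term by term. *)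
  have -> : J p = 0 *: J (h p) + 0 *: J ubar + (1 - 0 - 0) *: J p.
    by rewrite !scale0r !add0r !subr0 scale1r.
  have hx : h (x n) @[n --> \oo] --> h p.
    apply/cvgrPdist_le => e e0; near=> n.
    apply: le_trans (h_contr p (x n) Cp (KC n _ (Kx n))) _.
    apply: (@le_trans _ _ `|p - x n|); first by rewrite ler_piMl// ltW.
    by near: n; exact: cvgr_dist_le.
  apply: cvgD; [apply: cvgD|]; apply: cvgZ => //; [exact: cJ|exact: cvg_cst| |exact: cJ].
  by apply: cvgB => //; apply: cvgB => //; exact: cvg_cst.
have x1p : x n.+1 @[n --> \oo] --> p by rewrite (cvg_shiftS x).
have yp : y @ \oo --> p.
  apply: (@phi_cvg0r _ _ hconv hsmooth _ _ _ _ _ _ x1p).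
  apply: (@squeeze_cvgr _ _ _ _ (fun=> 0) (fun n => phi (x n.+1) (s n))).
  - apply: nearW => n; rewrite phi_ge0//=.
    (* The defining condition of [K n.+1] holds at its own element [x n.+1]. *)
    by have := Kx n.+1; rewrite K_def => -[].
  - exact: cvg_cst.
  by rewrite -(phixx hsmooth p); exact: cvg_phi.
have gap : phi b0 (s n) - phi b0 (y n) @[n --> \oo] --> (0 : R).
  rewrite -(subrr (phi b0 p)); apply: cvgB.
    by apply: cvg_phi => //; exact: cvg_cst.
  by apply: cvg_phi => //; exact: cvg_cst.
have gap_cvg (v : nat -> E) (al : R) : 0 < al ->
    (forall n, al * phi (v n) (s n) <= phi b0 (s n) - phi b0 (y n)) -> v @ \oo --> p.
  move=> al0 vs; apply: (@phi_cvg0l _ _ hconv hsmooth _ _ _ _ _ _ sp).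
  apply: (@squeeze_cvgr _ _ _ _ (fun=> 0)
    (fun n => al^-1 * (phi b0 (s n) - phi b0 (y n)))).
  - by apply: nearW => n; rewrite phi_ge0//= ler_pdivlMl.
  - exact: cvg_cst.
  by rewrite -[X in _ --> X](mulr0 al^-1); apply: cvgM => //; exact: cvg_cst.
have zp : z @ \oo --> p.
  apply: (gap_cvg _ alpha2) => // n; have := phi_y n b0 Bb0.
  by have := mulr_ge0 (ltW a30) (phi_ge0 hsmooth (u n) (s n)); lra.
have up : u @ \oo --> p.
  apply: (gap_cvg _ alpha3) => // n; have := phi_y n b0 Bb0.
  by have := mulr_ge0 (ltW a20) (phi_ge0 hsmooth (z n) (s n)); lra.
have Tup : T n (u n) @[n --> \oo] --> J p.
  have -> : (fun n => T n (u n)) = (fun n => alpha3^-1 *: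
      (J (y n) - alpha1 *: J (s n) - alpha2 *: J (z n))).
    apply/funext => n; rewrite y_def JinvK// -addrA -opprD addrAC subrr add0r.
    by rewrite scalerA mulVf ?scale1r// gt_eqF.
  have -> : J p = alpha3^-1 *: (J p - alpha1 *: J p - alpha2 *: J p).
    rewrite -[in X in X - _ - _](scale1r (J p)) -!scalerBl -alpha_sum scalerA.
    have -> : alpha3^-1 * (alpha1 + alpha2 + alpha3 - alpha1 - alpha2) = 1.
      by field; rewrite gt_eqF.
    by rewrite scale1r.
  apply: cvgZr; apply: cvgB; last by apply: cvgZr; exact: cJ.
  by apply: cvgB; [exact: cJ|apply: cvgZr; exact: cJ].
have cst0 (v w' : nat -> dualSpace E) (w : dualSpace E) :
    v @ \oo --> w -> w' @ \oo --> w -> (fun n => `|v n - w' n|) @ \oo --> (0 : R).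
  move=> vw ww; rewrite -(normr0 (dualSpace E)) -(subrr w).
  by apply: cvg_norm; exact: cvgB.

(* Membership of the limit in [B], and its identification *)
have pG : FJ_family C Gamma p.
  split => // S GS; split => //.
  have Sup : S (u n) @[n --> \oo] --> J p.
    have Su0 : S (u n) - J (u n) @[n --> \oo] --> (0 : dualSpace E).
      apply/norm_cvg0P; under eq_fun do rewrite distrC.
      apply: (nst u) => //; first by move=> n; exact: (uP n).1.
        have /cvg_seq_bounded : cvg (u @ \oo) by apply/cvg_ex; exists p.
        by move=> [M [Mr uM]]; exists M; split=> // k Mk _ [n _ <-]; exact: uM.
      exact: cst0 (cJ _ _ up) Tup.
    have -> : (fun n => S (u n)) = (fun n => (S (u n) - J (u n)) + J (u n)).
      by apply/funext => n; rewrite subrK.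
    by rewrite -[J p]add0r; apply: cvgD => //; exact: cJ.
  (* Both [u n] and [Jinv (S (u n))] tend to [p], so closedness gives [Jinv (S p) = p]. *)
  rewrite -[S p](JinvK hconv hsmooth); congr J.
  apply: (Gamma_closed S GS u) => //; [by move=> n; exact: (uP n).1|exact: cJinv].
have Bp : B p.
  rewrite B_def; split; first split => //.
    move=> i _; apply: (EP_limit hsmooth a_gt0 r_ge (fun n => (zP n).1) Cp zp sp
      JC_convex (f_cond i) (mu_inf i)).
    by move=> n w /= <- Cw; exact: (zP n).2.
  move=> j _; apply: (VI_limit hsmooth a_gt0 r_ge (fun n => (uP n).1) Cp up sp
    (A_cont j) (nu_inf j)).
  by move=> n w /= <- Cw; exact: (uP n).2.
have pq : p = q.
  apply: gproj_unique => //; apply: phi_min_variational => // p' Bp'.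
  have lim : G n @[n --> \oo] --> phi p (x 0%N).
    by apply: cvg_phi => //; exact: cvg_cst.
  apply: (cvgr_to_le lim); apply: nearW => n.
  by apply: le_trans (x_min n p' (BK n _ Bp')); rewrite lerDr phi_ge0.
split; last by rewrite -pq.
apply/seteqP; split=> [p' [Bp' p'P]|_ ->]; first exact: gproj_unique.
by have [] := gprojP hconv hsmooth (x 0%N) B_neq0 B_closed B_convex.
Unshelve. all: by end_near. Qed.
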